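(* Let $q\ge p\ge 3$ be coprime integers, let $Q_{\{p,q\}}(x)=\frac{(1-x^{pq})(1-x)}{(1-x^p)(1-x^q)}$ (a polynomial), and let $G(Q_{\{p,q\}})$ be its gapset. Let $k$ be the integer with $F_k<p\le F_{k+1}$, where $(F_n)$ are the Fibonacci numbers $F_1=1$, $F_2=2$, $F_{n+1}=F_n+F_{n-1}$. Then $$k\le \#G(Q_{\{p,q\}})\le p-1,$$ and both estimates are sharp (each bound is attained for some admissible pairs $(p,q)$).
   Context: For a polynomial $f$ with at least two nonzero coefficients, written as $f(x)=c_1x^{e_1}+\dots+c_kx^{e_k}$ with all $c_i\ne0$ and $0\le e_1<\dots<e_k$, its gapset is $G(f)=\{e_{i+1}-e_i\}$. *)

(* Defs.v *)
From mathcomp Require Import all_boot all_order all_algebra finmap.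
Set Implicit Arguments.
Unset Strict Implicit.
Unset Printing Implicit Defensive.
Import GRing.Theory.
Local Open Scope ring_scope.

Section Gapset.
Variable R : nzSemiRingType.

Definition exponents (f : {poly R}) : seq nat :=
  [seq i <- iota 0 (size f) | f`_i != 0].

(* Meaningful when f has at least two nonzero coefficients; empty otherwise. *)
Definition gapset (f : {poly R}) : {fset nat} :=
  let e := exponents f in
  [fset (nth 0%N e i.+1 - nth 0%N e i)%N | i in iota 0 (size e).-1]%fset.

End Gapset.

Definition Qnum (p q : nat) : {poly int} := (1 - 'X^(p * q)) * (1 - 'X).

Definition Qden (p q : nat) : {poly int} := (1 - 'X^p) * (1 - 'X^q).

(* For p, q > 0, Qden p q has leading coefficient 1, so this is Euclidean
   division in Z[x], with no pseudo-division scaling factor. *)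
Definition Qpoly (p q : nat) : {poly int} := Qnum p q %/ Qden p q.

(* Fibonacci numbers indexed so that F_1 = 1 and F_2 = 2, hence F_0 = 1; the
   index 0 never satisfies F_k < p <= F_(k+1). *)
Fixpoint fib (n : nat) : nat :=
  match n with
  | 0 => 1
  | 1 => 1
  | (m.+1 as n').+1 => fib n' + fib m
  end%N.

Definition admissible (p q : nat) : Prop :=
  [/\ (3 <= p)%N, (p <= q)%N & coprime p q].

(* Main.v *)
Require Import Defs.
From mathcomp Require Import all_boot all_order all_algebra finmap.
From mathcomp Require Import zify ring.
Import GRing.Theory.
Local Open Scope ring_scope.

(** Let S be the numerical semigroup generated by p and q.  Then Q is (1 - x)
    times the generating series of S, so its nonzero coefficients sit where
    membership in S changes, and the gapset is the set of lengths of the maximal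
    runs inside and outside S.  A run has length less than p because S contains
    the multiples of p and is stable under n |-> n + p.

    For the lower bound, S restricted to [j q, (j + 1) q) consists of the classes
    mod p of 0, q, ..., j q.  The distances between neighbours in these circular
    configurations follow the subtractive Euclidean algorithm started at
    (q mod p, p - q mod p): every pair (A, B) it visits gives a run of length
    A + B - 1.  If s_0 = p > s_1 > ... > s_T = 2 are the successive sums A + B,
    then s_(t+1) = max(A, B) and min(A, B) <= s_(t+2), so
    s_t <= s_(t+1) + s_(t+2) and p <= F_(T+2): there are at least T + 1 >= k
    distinct lengths.  Both bounds coincide for p = 3. *)

(** * Gaps as pairs of consecutive nonzero coefficients *)

Lemma gapsetP (R : nzSemiRingType) (f : {poly R}) (d : nat) :
  reflect (exists a b : nat, [/\ (a < b)%N, f`_a != 0, f`_b != 0,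
             forall n, (a < n < b)%N -> f`_n = 0 & d = (b - a)%N])
          (d \in gapset f).
Proof.
have memE n : (n \in exponents f) = (f`_n != 0).
  rewrite mem_filter mem_iota /= add0n.
  by case: (ltnP n (size f)) => [_|/(nth_default 0) ->]; rewrite ?andbT ?eqxx.
have srt : sorted ltn (exponents f).
  exact: (sorted_filter ltn_trans _ (iota_ltn_sorted _ _)).
have nth_lt i j : (i < size (exponents f))%N -> (j < size (exponents f))%N ->
    (nth 0 (exponents f) i < nth 0 (exponents f) j)%N = (i < j)%N.
  move=> iP jP; have homo := sorted_ltn_nth ltn_trans 0%N srt.
  case: (ltngtP i j) => [ij|ji|->]; last by rewrite ltnn.
    by rewrite homo ?inE.
  by apply/negbTE; rewrite -leqNgt ltnW // homo ?inE.
apply: (iffP (imfsetP _ _ _ _)) => /=.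
  move=> [i]; rewrite mem_iota add0n => /= iP ->.
  have i1P : (i.+1 < size (exponents f))%N by lia.
  have iP' : (i < size (exponents f))%N by lia.
  exists (nth 0%N (exponents f) i), (nth 0%N (exponents f) i.+1).
  split; rewrite -?memE ?mem_nth //.
    by rewrite nth_lt.
  move=> n /andP[lo hi]; apply/eqP/negPn; rewrite -memE; apply/negP => nP.
  have jP : (index n (exponents f) < size (exponents f))%N by rewrite index_mem.
  move: lo hi; rewrite -(nth_index 0%N nP).
  rewrite !nth_lt //.
  lia.
move=> [a [b [ab fa fb fn ->]]].
have aP : a \in exponents f by rewrite memE.
have bP : b \in exponents f by rewrite memE.
have iaP : (index a (exponents f) < size (exponents f))%N by rewrite index_mem.
have ibP : (index b (exponents f) < size (exponents f))%N by rewrite index_mem.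
have iab : (index a (exponents f) < index b (exponents f))%N.
  by rewrite -nth_lt // !nth_index.
exists (index a (exponents f)); first by rewrite mem_iota add0n /=; lia.
rewrite nth_index //; congr (_ - _)%N.
have i1P : ((index a (exponents f)).+1 < size (exponents f))%N by lia.
have mP := mem_nth 0%N i1P; set m := nth _ _ _ in mP *.
have am : (a < m)%N.
  by rewrite -{1}(nth_index 0%N aP) nth_lt.
case: (ltngtP m b) => // [mb|bm].
  by move: mP; rewrite memE fn ?eqxx // am.
move: bm; rewrite -{1}(nth_index 0%N bP) nth_lt //.
lia.
Qed.

Lemma sum_powers_mul (R : comPzRingType) (x : R) (m : nat) :
  (1 - x) * \sum_(i < m) x ^+ i = 1 - x ^+ m.
Proof.
rewrite -[in RHS](expr1n _ m) subrXX; congr (_ * _).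
by apply: eq_bigr => i _; rewrite expr1n mul1r.
Qed.

(** * The numerical semigroup and its Apery set *)

(** Boolean membership in the semigroup by a finite search: for [q > 0] a multiplicity of [q] never
    exceeds [n]. *)
Definition insg (p q n : nat) : bool :=
  [exists i : 'I_n.+1, (i * q <= n)%N && (p %| n - i * q)%N].

Lemma insgP (p q n : nat) : (0 < q)%N ->
  reflect (exists i l : nat, n = (i * q + l * p)%N) (insg p q n).
Proof.
move=> q0; apply: (iffP existsP) => [[i /andP[le /dvdnP[l e]]]|[i [l e]]].
  by exists i, l; rewrite -e subnKC.
have ilt : (i < n.+1)%N by nia.
by exists (Ordinal ilt); rewrite /= e leq_addr addKn dvdn_mull.
Qed.

Section TwoGenerators.
Variables p q : nat.
Hypotheses (p0 : (0 < p)%N) (q0 : (0 < q)%N) (cpq : coprime p q).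

Let S := insg p q.

Lemma insgDp n : S n -> S (n + p).
Proof.
by move=> /(insgP _ _ _ q0)[i [l ->]]; apply/insgP=> //; exists i, l.+1; lia.
Qed.

Lemma modM_inj i j : (i < p)%N -> (j < p)%N -> i * q = j * q %[mod p] -> i = j.
Proof.
wlog ij : i j / (i <= j)%N.
  move=> H ip jp e; case: (leqP i j) => [|/ltnW] ij; first exact: H.
  by apply/esym/H.
move=> ip jp /eqP; rewrite eq_sym eqn_mod_dvd ?leq_mul2r ?ij ?orbT //.
rewrite -mulnBl Gauss_dvdl // => /dvdnP[[|m] e]; nia.
Qed.

Lemma modM_surj n : exists2 i, (i < p)%N & i * q = n %[mod p].
Proof.
have [u e] : exists u, q * u = 1 %[mod p].
  case: (egcdnP p q0) => u v e _; exists u.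
  by rewrite mulnC e gcdnC (eqP cpq) modnMDl.
exists (n * u %% p)%N; first exact: ltn_pmod.
by rewrite modnMml -mulnA (mulnC u) -modnMmr e modnMmr muln1.
Qed.

Lemma insg_large n : (p * q <= n)%N -> S n.
Proof.
move=> le; have [i ip e] := modM_surj n.
have leiq : (i * q <= n)%N by nia.
have /dvdnP[l el] : (p %| n - i * q)%N by rewrite -eqn_mod_dvd // e.
by apply/insgP=> //; exists i, l; lia.
Qed.

(** The left side defines the Apery set of [S] with respect to [p]; it consists of the least
    elements of [S] in the classes mod [p]. *)
Lemma insg_apery n : S n && ((p <= n)%N ==> ~~ S (n - p)) =
  [exists i : 'I_p, n == (i * q)%N].
Proof.
apply/andP/existsP => [[/(insgP _ _ _ q0)[i [l e]] /implyP h]|[i /eqP e]].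
  case: l e => [|l] e; last first.
    by case/negP: (h ltac:(lia)); apply/insgP=> //; exists i, l; lia.
  have ip : (i < p)%N.
    (* If [i >= p], trading [p] copies of [q] for [q] copies of [p] leaves a copy of [p] to
       remove. *)
    rewrite ltnNge; apply/negP => pi; case/negP: (h ltac:(nia)).
    by apply/insgP=> //; exists (i - p)%N, q.-1; nia.
  by exists (Ordinal ip); rewrite e /=; lia.
split; first by apply/insgP=> //; exists i, 0%N; lia.
apply/implyP => le; apply/negP => /(insgP _ _ _ q0)[j [l e2]].
have ji : (j < i)%N by have := ltn_ord i; nia.
have e3 : (i * q = l.+1 * p + j * q)%N by lia.
have := @modM_inj j i (ltn_trans ji (ltn_ord i)) (ltn_ord i).
rewrite e3 modnMDl => /(_ erefl); lia.
Qed.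

(** * The coefficients of [Qpoly] *)

(** The complement of [S] is used because it is finite, whereas the generating series of [S] is not
    a polynomial. *)
Definition gap_poly : {poly int} := \poly_(n < p * q) (~~ S n)%:R.

Lemma coef_gap_poly n : gap_poly`_n = (~~ S n)%:R.
Proof.
rewrite coef_poly; case: ltnP => // le.
by rewrite insg_large.
Qed.

(** Multiplication by [1 - 'X^p] takes differences along steps of [p]: the series of all integers
    leaves the first [p] powers, that of [S] leaves the Apery set. *)
Lemma gap_poly_apery :
  (1 - 'X^p) * gap_poly = \sum_(i < p) 'X^i - \sum_(i < p) 'X^(i * q).
Proof.
apply/polyP => n.
rewrite mulrBl mul1r !coefB coefXnM !coef_gap_poly !coef_sum.
have E1 : \sum_(i < p) ('X^i : {poly int})`_n = (n < p)%N%:R.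
  under eq_bigr do rewrite coefXn.
  case: (ltnP n p) => np.
    rewrite (bigD1 (Ordinal np)) //= eqxx big1 ?addr0 // => i.
    by rewrite -val_eqE /= eq_sym => /negbTE ->.
  by rewrite big1 // => i _; case: eqP => // e; have := ltn_ord i; lia.
have E2 : \sum_(i < p) ('X^(i * q) : {poly int})`_n =
    (S n && ((p <= n)%N ==> ~~ S (n - p)))%:R.
  rewrite insg_apery; under eq_bigr do rewrite coefXn.
  case: existsP => [[i /eqP e]|h].
    rewrite (bigD1 i) //= e eqxx big1 ?addr0 // => j ji.
    case: eqP => // e2; case/eqP: ji; apply/val_inj/eqP => /=.
    by rewrite -(eqn_pmul2r q0) e2.
  by rewrite big1 // => i _; case: eqP => // e; case: h; exists i; apply/eqP.
rewrite E1 E2; case: (ltnP n p) => np /=; first by case: (S n).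
have := @insgDp (n - p); rewrite subnK //.
by case: (S (n - p)); case: (S n) => //= /(_ isT).
Qed.

Lemma Qpoly_exact : (1 - (1 - 'X) * gap_poly) * Qden p q = Qnum p q.
Proof.
have A := gap_poly_apery.
have B := sum_powers_mul _ ('X : {poly int}) p.
have C := sum_powers_mul _ ('X^q : {poly int}) p.
have D : \sum_(i < p) ('X^q ^+ i : {poly int}) = \sum_(i < p) 'X^(i * q).
  by apply: eq_bigr => i _; rewrite -exprM mulnC.
rewrite D -exprM (mulnC q) in C.
rewrite /Qden /Qnum -C.
have -> : (1 - (1 - 'X) * gap_poly) * ((1 - 'X^p) * (1 - 'X^q)) =
  (1 - 'X^q) * ((1 - 'X^p) - (1 - 'X) * ((1 - 'X^p) * gap_poly)) by ring.
rewrite A -B; ring.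
Qed.

Lemma QpolyE : Qpoly p q = 1 - (1 - 'X) * gap_poly.
Proof.
rewrite /Qpoly -Qpoly_exact Pdiv.IdomainMonic.mulpK //.
rewrite /Qden -mulrNN !opprB monicMl ?monicXnsubC //.
Qed.

Lemma Qpoly_coef_neq0 n :
  ((Qpoly p q)`_n != 0) = (n == 0%N) || (S n != S n.-1).
Proof.
rewrite QpolyE mulrBl mul1r opprB coefD coefB coef1 coefXM !coef_gap_poly.
case: n => [|n] /=.
  suff -> : S 0 by [].
  by apply/insgP => //; exists 0%N, 0%N.
by case: (S n); case: (S n.+1).
Qed.

(** * Run lengths: the bound by [p] and the Euclidean family *)

Lemma gapset_lt d : d \in gapset (Qpoly p q) -> (0 < d < p)%N.
Proof.
move=> /gapsetP[a [b [ab _ fb fn ->]]].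
rewrite Qpoly_coef_neq0 in fb.
have cst n : (a <= n < b)%N -> S n = S a.
  elim: n => [|n IH] /andP[an nb]; first by rewrite (_ : a = 0%N) //; lia.
  case: (ltngtP a n.+1) => [an'|/ltn_geF|->] //; last by rewrite an.
  rewrite -IH; last by lia.
  apply: contraTeq isT => Sn; have := Qpoly_coef_neq0 n.+1.
  by rewrite fn ?eqxx /= ?Sn //; lia.
rewrite subn_gt0 ab /= ltnNge; apply/negP => pab.
have Sb : S b != S a.
  by rewrite -(cst b.-1) //; [case/orP: fb => [/eqP b0|//]; lia|lia].
case Sa : (S a) Sb => Sb.
  case/negP: Sb; apply/eqP.
  by rewrite -(subnK (_ : p <= b)%N) ?insgDp ?cst //; lia.
(* The least multiple of [p] from [a] on; it falls inside the run. *)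
suff : S (a %/ p * p + (if p %| a then 0 else p))%N.
  rewrite cst ?Sa //; have := ltn_pmod a p0; have := divn_eq a p.
  by rewrite /dvdn; case: eqP => *; lia.
by apply/insgP => //; exists 0%N; case: ifP => _; [exists (a %/ p)%N|exists (a %/ p).+1]; lia.
Qed.

(* [(u, A)] and [(- v, B)] form a basis of the lattice of the pairs [(n, x)]
   with [x] congruent to [n q] mod [p]; the signs of the coordinates [al], [be]
   of [(n, x)] in this basis decide. *)
Lemma lattice_box (u v A B a b : nat) (n c : int) :
  (0 < A)%N -> (0 < B)%N -> (u * q = A + a * p)%N -> (v * q + B = b * p)%N ->
  (v * A + u * B = p)%N -> - v%:Z < n -> n < u%:Z ->
  0 < n * q%:Z + c * p%:Z -> A%:Z + B%:Z <= n * q%:Z + c * p%:Z.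
Proof.
move=> A0 B0 uq vq det lo hi x0.
set x := _ + _ in x0 *.
pose al := n * b%:Z + v%:Z * c; pose be := u%:Z * c + n * a%:Z.
have Euq : u%:Z * q%:Z = A%:Z + a%:Z * p%:Z by lia.
have Evq : v%:Z * q%:Z + B%:Z = b%:Z * p%:Z by lia.
have Edet : v%:Z * A%:Z + u%:Z * B%:Z = p%:Z by lia.
have pal : p%:Z * al = n * B%:Z + v%:Z * x.
  rewrite /al /x mulrDr mulrCA [_ * b%:Z]mulrC -Evq; ring.
have pbe : p%:Z * be = u%:Z * x - n * A%:Z.
  have -> : A%:Z = u%:Z * q%:Z - a%:Z * p%:Z by rewrite Euq addrK.
  rewrite /be /x; ring.
have pz : p%:Z != 0 by lia.
have ex : x = al * A%:Z + be * B%:Z.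
  apply: (mulfI pz).
  have -> : p%:Z * (al * A%:Z + be * B%:Z) =
    (p%:Z * al) * A%:Z + (p%:Z * be) * B%:Z by ring.
  rewrite pal pbe -Edet; ring.
have en : n = al * u%:Z - be * v%:Z.
  apply: (mulfI pz).
  have -> : p%:Z * (al * u%:Z - be * v%:Z) =
    (p%:Z * al) * u%:Z - (p%:Z * be) * v%:Z by ring.
  rewrite pal pbe -Edet; ring.
clearbody al be x; clear pal pbe.
(* Both coordinates positive gives [x >= A + B], both nonpositive gives [x <= 0]; mixed signs give
   [n >= u] or [n <= - v]. *)
case: (Num.Theory.lerP al 0) => ha; case: (Num.Theory.lerP be 0) => hb; nia.
Qed.

(** Among the classes of [0, q, ..., (u + v - 2) q], those of [(v - 1) q] and [(u - 1) q] are
    neighbours at distance [A + B], since [lattice_box] excludes any class between them. *)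
Lemma euclid_gap (u v A B a b : nat) : (p <= q)%N ->
  (0 < u)%N -> (0 < v)%N -> (0 < A)%N -> (0 < B)%N ->
  (u * q = A + a * p)%N -> (v * q + B = b * p)%N -> (v * A + u * B = p)%N ->
  (A + B - 1)%N \in gapset (Qpoly p q).
Proof.
move=> pq u0 v0 A0 B0 uq vq det.
have box := @lattice_box u v A B a b _ _ A0 B0 uq vq det.
(* The gap starts at the element [g] congruent to [(v - 1) q] in the window
   [[j q, j q + p)], where [j q] is the Apery element splitting that gap. *)
pose j := (u + v - 2)%N.
have jE : (j + 2 = u + v)%N by rewrite /j; lia.
clearbody j.
have [l [gl gh]] : exists l, (j * q <= (v - 1) * q + l * p)%N /\
    ((v - 1) * q + l * p < j * q + p)%N.
  pose m := ((u - 1) * q)%N; exists ((m + p.-1) %/ p)%N.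
  have jm : (j * q = (v - 1) * q + m)%N by rewrite /m -mulnDl; congr (_ * _)%N; lia.
  have := divn_eq (m + p.-1) p; have := ltn_pmod (m + p.-1) p0; lia.
set g := ((v - 1) * q + l * p)%N in gl gh.
have gE : g%:Z = (v%:Z - 1) * q%:Z + l%:Z * p%:Z by rewrite /g PoszD !PoszM -subzn.
have gAB : (g + (A + B) <= j * q + p)%N.
  have := @box (j%:Z - v%:Z + 1) (1 - l%:Z).
  have -> : (j%:Z - v%:Z + 1) * q%:Z + (1 - l%:Z) * p%:Z =
     (j * q + p)%:Z - g%:Z by rewrite gE; lia.
  lia.
have notS x : (0 < x < A + B)%N -> ~~ S (g + x).
  move=> /andP[x0 xAB]; apply/negP => /(insgP _ _ _ q0)[i [m e]].
  (* Here [p <= q] matters: the window ends by [(j + 1) q], so no new class has appeared yet. *)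
  have ij : (i <= j)%N.
    rewrite leqNgt; apply/negP => ji.
    have : (j.+1 * q <= i * q)%N by rewrite leq_mul2r ji orbT.
    by rewrite mulSn; lia.
  have := @box (i%:Z - v%:Z + 1) (m%:Z - l%:Z).
  have -> : (i%:Z - v%:Z + 1) * q%:Z + (m%:Z - l%:Z) * p%:Z = x%:Z.
    have : (g + x)%:Z = i%:Z * q%:Z + m%:Z * p%:Z by lia.
    rewrite PoszD gE; lia.
  lia.
have Sg : S g by apply/insgP=> //; exists (v - 1)%N, l.
have SgAB : S (g + (A + B)).
  apply/insgP=> //; exists (u - 1)%N, (l + b - a)%N.
  have e1 : (g + (A + B) + a * p = (u - 1) * q + (l + b) * p)%N.
    have vE : (v * q = (v - 1) * q + q)%N by rewrite -mulSnr; congr (_ * _)%N; lia.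
    have uE : (u * q = (u - 1) * q + q)%N by rewrite -mulSnr; congr (_ * _)%N; lia.
    rewrite /g; lia.
  have le : ((u - 1) * q <= j * q)%N by rewrite leq_mul2r; lia.
  have ab : (a * p <= (l + b) * p)%N by lia.
  by rewrite (mulnBl (l + b)%N); lia.
apply/gapsetP; exists g.+1, (g + (A + B))%N; split.
- lia.
- by rewrite Qpoly_coef_neq0 /= Sg -addn1 (negbTE (notS 1%N _)) ?orbT //; lia.
- rewrite Qpoly_coef_neq0 SgAB (_ : (g + (A + B)).-1 = g + (A + B - 1))%N; last by lia.
  by rewrite (negbTE (notS _ _)) ?orbT //; lia.
- move=> n /andP[n1 n2]; apply/eqP/negPn; rewrite Qpoly_coef_neq0.
  rewrite (_ : n = g + (n - g))%N; last by lia.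
  rewrite (_ : (g + (n - g)).-1 = g + (n - g - 1))%N; last by lia.
  by rewrite !(negbTE (notS _ _)) ?orbF ?negbK; lia.
- lia.
Qed.

Local Open Scope fset_scope.

(** The bound on [maxn A B] is carried along to supply the smaller Fibonacci summand at the next
    step; the bound on the elements of [X] makes each new gap distinct from the others. *)
Lemma euclid_fib (u v A B a b : nat) : (p <= q)%N -> coprime A B ->
  (0 < u)%N -> (0 < v)%N -> (0 < A)%N -> (0 < B)%N ->
  (u * q = A + a * p)%N -> (v * q + B = b * p)%N -> (v * A + u * B = p)%N ->
  exists X : {fset nat}, [/\ X `<=` gapset (Qpoly p q),
    forall x, x \in X -> (x < A + B)%N,
    (maxn A B <= fib #|` X|)%N & (A + B <= fib #|` X|.+1)%N].
Proof.
move=> pq; have [N le] := ubnP (A + B).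
elim: N u v A B a b le => // N IH u v A B a b le cAB u0 v0 A0 B0 uq vq det.
have gapAB := @euclid_gap u v A B a b pq u0 v0 A0 B0 uq vq det.
case: (ltngtP A B) => [AB|BA|AB].
- have [] := IH u (u + v)%N A (B - A)%N a (a + b)%N; try lia.
    by rewrite /coprime -gcdnDl subnKC // ltnW.
  move=> X [XG Xlt Xm Xs]; exists ((A + B - 1)%N |` X).
  have nX : (A + B - 1)%N \notin X by apply/negP => /Xlt; lia.
  split.
  + by rewrite fsubUset fsub1set gapAB.
  + by move=> x /fset1UP[->|/Xlt]; lia.
  + by rewrite cardfsU1 nX add1n; lia.
  + by rewrite cardfsU1 nX add1n /=; move: Xm Xs => /=; lia.
- have [] := IH (u + v)%N v (A - B)%N B (a + b)%N b; try lia.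
    by rewrite coprime_sym /coprime -gcdnDl subnKC ?(ltnW BA) // -/(coprime B A) coprime_sym.
  move=> X [XG Xlt Xm Xs]; exists ((A + B - 1)%N |` X).
  have nX : (A + B - 1)%N \notin X by apply/negP => /Xlt; lia.
  split.
  + by rewrite fsubUset fsub1set gapAB.
  + by move=> x /fset1UP[->|/Xlt]; lia.
  + by rewrite cardfsU1 nX add1n; lia.
  + by rewrite cardfsU1 nX add1n /=; move: Xm Xs => /=; lia.
(* By coprimality the subtraction stops at [A = B = 1], which yields the gap 1. *)
- have A1 : A = 1%N by move: cAB; rewrite -AB /coprime gcdnn => /eqP.
  exists [fset (A + B - 1)%N]; rewrite cardfs1 fsub1set gapAB -AB A1; split=> //.
  by move=> x /fset1P ->.
Qed.

End TwoGenerators.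

(** * Cardinality bounds and sharpness *)

Lemma leq_fib (m n : nat) : (m <= n)%N -> (fib m <= fib n)%N.
Proof.
move=> /subnK <-; elim: (n - m)%N => // d /leq_trans; apply.
by rewrite addSn; case: (d + m)%N => // k; rewrite leq_addr.
Qed.

Lemma card_gapset_ub (p q : nat) : admissible p q ->
  (#|` gapset (Qpoly p q)| <= p - 1)%N.
Proof.
move=> [p3 pq cpq].
have := @uniq_leq_size _ (gapset (Qpoly p q)) (iota 1 (p - 1)) (fset_uniq _).
rewrite size_iota; apply => d /gapset_lt H.
by rewrite mem_iota; have := H ltac:(lia) ltac:(lia) cpq; lia.
Qed.

Lemma card_gapset_lb (p q k : nat) : admissible p q -> (fib k < p)%N ->
  (k <= #|` gapset (Qpoly p q)|)%N.
Proof.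
move=> [p3 pq cpq] kp.
have p0 : (0 < p)%N by lia.
have q0 : (0 < q)%N by lia.
have Aq := divn_eq q p; have Alt := ltn_pmod q p0.
have cA : coprime (q %% p) p by rewrite coprime_modl coprime_sym.
have A0 : (0 < q %% p)%N.
  by case: (q %% p)%N cA => //; rewrite /coprime gcd0n => /eqP; lia.
have cAB : coprime (q %% p) (p - q %% p).
  by rewrite /coprime -gcdnDl subnKC // ltnW.
(* The algorithm starts with [u = v = 1], where [A + B = p]. *)
have [] := @euclid_fib p q p0 q0 cpq 1 1 (q %% p) (p - q %% p) (q %/ p)
  (q %/ p).+1 pq cAB; try lia.
move=> X [XG _ _]; rewrite subnKC ?(ltnW Alt) // => pX.
apply: leq_trans (fsubset_leq_card XG).
rewrite leqNgt; apply/negP => /leq_fib; lia.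
Qed.

Theorem theorem3 :
  (forall p q : nat, admissible p q ->
     Qpoly p q * Qden p q = Qnum p q /\
     forall k : nat, (fib k < p <= fib k.+1)%N ->
       (k <= #|` gapset (Qpoly p q)| <= p - 1)%N) /\
  (exists p q k : nat, [/\ admissible p q, (fib k < p <= fib k.+1)%N
     & #|` gapset (Qpoly p q)| = k]) /\
  (exists p q : nat, admissible p q /\ #|` gapset (Qpoly p q)| = (p - 1)%N).
Proof.
have adm34 : admissible 3 4 by split.
have card34 : #|` gapset (Qpoly 3 4)| = 2%N.
  have := card_gapset_ub _ _ adm34.
  by have := card_gapset_lb _ _ 2 adm34 isT; lia.
split; last by split; [exists 3, 4, 2|exists 3, 4].
move=> p q adm; have [p3 pq cpq] := adm; split.
  by rewrite QpolyE ?Qpoly_exact //; lia.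
by move=> k /andP[kp _]; rewrite card_gapset_lb ?card_gapset_ub.
Qed.
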